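(* Let $A\in\mathbb{C}$, $-1\le B\le 0$, $A\ne B$, let $f_{j,k}\in\mathcal{ST}_{[j,k]}(A,B)$, and let $t\le 2$ (real). Then the logarithmic coefficients $d_{n(j+k-1)}$ of $f_{j,k}$ satisfy $$\sum_{n=1}^{\infty}(n+1)^t\,|d_{n(j+k-1)}|^{2}\le \left(\frac{|A-B|}{2(j+k-1)B}\right)^2\sum_{n=1}^{\infty}\frac{(n+1)^t}{n^2}\,B^{2n},$$ where for $B=0$ the right-hand side is understood as its limit value as the factor $1/B^2$ is absorbed into the sum.
   Context: $\mathbb{D}=\{z\in\mathbb{C}:|z|<1\}$; $\mathcal{A}$ is the class of analytic functions $f$ in $\mathbb{D}$ with $f(0)=0$, $f'(0)=1$. For analytic $p,q$ in $\mathbb{D}$, $p\prec q$ (subordination) means $p=q\circ\omega$ for some analytic $\omega:\mathbb{D}\to\mathbb{D}$ with $\omega(0)=0$. Here $k\in\mathbb{N}$ and $j\in\{0,1,\dots,k-1\}$, the case $(j,k)=(1,1)$ also being allowed, with $j+k-1\ge1$. A function $f:\mathbb{D}\to\mathbb{C}$ is called $(j,k)$-symmetric if $f(\epsilon z)=\epsilon^{j}f(z)$ for all $z\in\mathbb{D}$, where $\epsilon=e^{2\pi i/k}$. The class $\mathcal{ST}_{[j,k]}(A,B)$ is the class of $(j,k)$-symmetric functions in $\mathcal{A}$ of the form $$f_{j,k}(z)=z+\sum_{n=1}^\infty a_{nk+j}z^{nk+j},\qquad z\in\mathbb{D},$$ which satisfy $$\frac{z f_{j,k}'(z)}{f_{j,k}(z)}\prec\frac{1+Az^{j+k-1}}{1+Bz^{j+k-1}},\qquad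 z\in\mathbb{D}.$$ The logarithmic coefficients $d_{n(j+k-1)}$ of $f_{j,k}$ are defined by $$\log\left(\frac{f_{j,k}(z)}{z}\right)=2\sum_{n=1}^\infty d_{n(j+k-1)}z^{n(j+k-1)},\qquad z\in\mathbb{D}.$$ *)

(* Defs.v *)
From Stdlib Require Export Reals.
From Coquelicot Require Export Coquelicot.

Open Scope R_scope.

(** Functions on the unit disc are functions [C -> C] of which only the values
    on the disc are used. *)

Definition unit_disc (z : C) : Prop := Cmod z < 1.

Definition analytic_on_disc (f : C -> C) : Prop :=
  forall z : C, unit_disc z -> @ex_derive C_AbsRing C_NormedModule f z.

Definition class_A (f : C -> C) : Prop :=
  analytic_on_disc f /\ f (RtoC 0) = RtoC 0 /\ C_derive f (RtoC 0) = RtoC 1.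

Definition subordinate (p q : C -> C) : Prop :=
  analytic_on_disc p /\ analytic_on_disc q /\
  exists w : C -> C,
    analytic_on_disc w /\
    (forall z, unit_disc z -> unit_disc (w z)) /\
    w (RtoC 0) = RtoC 0 /\
    (forall z, unit_disc z -> p z = q (w z)).

(** [is_csum1 a l] : the sum of [a n] over [n >= 1] converges to [l]. *)
Definition is_csum1 (a : nat -> C) (l : C) : Prop :=
  @is_series C_AbsRing C_NormedModule (fun n => a (S n)) l.

(** Sum over [n >= 1] of nonnegative terms, with values in [[0, +oo]]: the
    partial sums are nondecreasing, so [Lim_seq] is their limit, and it is
    [p_infty] exactly when the series diverges. *)
Definition rsum1 (u : nat -> R) : Rbar :=
  Lim_seq (sum_n (fun n => u (S n))).

Definition Cexp (z : C) : C :=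
  (exp (Re z) * cos (Im z), exp (Re z) * sin (Im z)).

Definition root_of_unity (k : nat) : C :=
  (cos (2 * PI / INR k), sin (2 * PI / INR k)).

Definition jk_symmetric (j k : nat) (f : C -> C) : Prop :=
  forall z, unit_disc z ->
    f (root_of_unity k * z)%C = (root_of_unity k ^ j * f z)%C.

(** The function [z f'(z) / f(z)] for [f] with [f 0 = 0], [f' 0 = 1]: its
    singularity at the origin is removable, with value 1. *)
Definition zf'_over_f (f : C -> C) (z : C) : C :=
  if Ceq_dec z (RtoC 0) then RtoC 1 else (z * C_derive f z / f z)%C.

(** [f z <> 0] for [z <> 0] is part of the meaning of [z f'(z) / f(z)] being a
    function on the disc; division in [C] is total. *)
Definition class_ST (j k : nat) (A : C) (B : R) (f : C -> C) : Prop :=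
  class_A f /\
  jk_symmetric j k f /\
  (exists a : nat -> C, forall z, unit_disc z ->
     is_csum1 (fun n => a (n * k + j)%nat * z ^ (n * k + j))%C (f z - z)%C) /\
  (forall z, unit_disc z -> z <> RtoC 0 -> f z <> RtoC 0) /\
  subordinate (zf'_over_f f)
    (fun z => (1 + A * z ^ (j + k - 1)) / (1 + RtoC B * z ^ (j + k - 1)))%C.

Definition admissible (j k : nat) : Prop :=
  ((j < k)%nat \/ (j = 1%nat /\ k = 1%nat)) /\ (1 <= j + k - 1)%nat.

(** [L] is the branch of [log (f z / z)] that is analytic on the disc and
    vanishes at the origin; only the values of [d] at positive multiples of [m]
    matter. *)
Definition log_coefficients (m : nat) (f : C -> C) (d : nat -> C) : Prop :=
  exists L : C -> C,
    analytic_on_disc L /\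
    L (RtoC 0) = RtoC 0 /\
    (forall z, unit_disc z -> z <> RtoC 0 -> Cexp (L z) = (f z / z)%C) /\
    (forall z, unit_disc z -> exists s : C,
       is_csum1 (fun n => d (n * m)%nat * z ^ (n * m))%C s /\
       L z = (2 * s)%C).

(* Main.v *)
Require Import Defs.
From Stdlib Require Import Lra Lia.

(** Put [m = j + k - 1], [D = A - B], [c_n = 2 n m d_{nm}] and
    [g(z) = z f'(z) / f(z) - 1 = sum c_n z^(nm)]. Subordination gives
    [g = w^m (D - B g)] with [|w| < 1], hence only the pointwise bound
    [|g| <= |D - B g|] is needed. Multiplying both sides by [x = 1 + beta z^(Nm)]
    with [beta = B c_N / D] cancels the [N]-th coefficient of [(D - B g) x] and
    leaves the first [N] coefficients of [g] unchanged; comparing the two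
    functions on circles by Parseval, the coefficients of index [> N] of
    [(D - B g) x] are [-B] times those of [g x] and [|B| <= 1], so
    [sum_{n <= N} |c_n|^2 <= |D|^2 + B^2 sum_{n < N} |c_n|^2].
    Thus [sum_{n <= N} |c_n|^2 <= |D|^2 sum_{n < N} B^(2n)] for all [N], and summation by
    parts against the nonincreasing weights [(n + 1)^t / n^2], [t <= 2], concludes. *)

(* [ring] and [field] do not see through the carrier projections that [sum_n]
   and [is_series] leave in the type of an equation. *)
Ltac ring_R := match goal with |- ?a = ?b => change (@eq R a b) end; ring.

Ltac ring_C := match goal with |- ?a = ?b => change (@eq C a b) end; ring.

(** * Points of the unit circle and sums over roots of unity *)

Definition cis (x : R) : C := (cos x, sin x).

Lemma C_eq (z w : C) : Re z = Re w -> Im z = Im w -> z = w.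
Proof. destruct z, w; simpl; intros; subst; reflexivity. Qed.

Lemma cis_plus (x y : R) : cis (x + y) = (cis x * cis y)%C.
Proof.
  unfold cis, Cmult; simpl; rewrite cos_plus, sin_plus; f_equal; ring.
Qed.

Lemma cis_0 : cis 0 = 1%C.
Proof. unfold cis; now rewrite cos_0, sin_0. Qed.

Lemma cis_pow (x : R) (n : nat) : (cis x ^ n)%C = cis (INR n * x).
Proof.
  induction n as [|n IH].
  - simpl; rewrite Rmult_0_l; symmetry; apply cis_0.
  - rewrite Cpow_S, IH, <- cis_plus; f_equal; rewrite S_INR; ring.
Qed.

Lemma Cmod_cis (x : R) : Cmod (cis x) = 1.
Proof.
  unfold Cmod, cis; simpl; rewrite !Rmult_1_r.
  replace (cos x * cos x + sin x * sin x) with 1; [apply sqrt_1|].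
  generalize (sin2_cos2 x); unfold Rsqr; lra.
Qed.

Lemma cis_2PI_mult (k : nat) : cis (2 * PI * INR k) = 1%C.
Proof.
  unfold cis.
  replace (2 * PI * INR k) with (0 + 2 * INR k * PI) by ring.
  now rewrite cos_period, sin_period, cos_0, sin_0.
Qed.

Lemma cis_neq_1 (x : R) : 0 < x < 2 * PI -> cis x <> 1%C.
Proof.
  intros Hx E.
  assert (Hc : cos x = 1) by (apply (f_equal Re) in E; exact E).
  assert (Hs : 0 < sin (x / 2)) by (apply sin_gt_0; lra).
  replace x with (2 * (x / 2)) in Hc by field.
  rewrite cos_2a_sin in Hc; nra.
Qed.

Lemma geom_sum_C (w : C) (n : nat) :
  ((w - 1) * sum_n (fun l => w ^ l) n)%C = (w ^ S n - 1)%C.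
Proof.
  induction n as [|n IH].
  - rewrite sum_O; simpl; ring.
  - rewrite sum_Sn; change plus with Cplus.
    rewrite Cmult_plus_distr_l, IH, !Cpow_S; ring.
Qed.

(* The arguments of the [(q + 1)]-th roots of unity. *)
Definition node (q l : nat) : R := 2 * PI * INR l / INR (S q).

(** The summands are the powers of [cis x] with [x = 2 PI k / (q + 1)]. Its power of exponent
    [q + 1] is 1, while [0 < k <= q] puts [x] strictly between 0 and [2 PI] and so keeps [cis x]
    away from 1; hence the geometric sum vanishes. *)
Lemma sum_cis_node (q k : nat) :
  (0 < k <= q)%nat -> sum_n (fun l => cis (INR k * node q l)) q = RtoC 0.
Proof.
  intros Hk.
  assert (HS : 0 < INR (S q)) by (apply lt_0_INR; lia).
  set (x := 2 * PI * INR k / INR (S q)).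
  assert (Hx : 0 < x < 2 * PI).
  { assert (0 < INR k) by (apply lt_0_INR; lia).
    assert (INR k < INR (S q)) by (apply lt_INR; lia).
    pose proof PI_RGT_0.
    unfold x; split.
    - apply Rdiv_lt_0_compat; nra.
    - apply (Rmult_lt_reg_r (INR (S q))); [assumption|].
      unfold Rdiv; rewrite Rmult_assoc, Rinv_l; nra. }
  rewrite (sum_n_ext _ (fun l => cis x ^ l)%C).
  2:{ intros l; rewrite cis_pow; f_equal; unfold x, node; field; lra. }
  pose proof (geom_sum_C (cis x) q) as G.
  rewrite cis_pow in G.
  replace (INR (S q) * x) with (2 * PI * INR k) in G by (unfold x; field; lra).
  rewrite cis_2PI_mult in G.
  replace (1 - 1)%C with (RtoC 0) in G by ring.
  assert (N : (cis x - 1)%C <> 0%C).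
  { intros E; apply (cis_neq_1 x Hx).
    replace (cis x) with ((cis x - 1) + 1)%C by ring; rewrite E; ring. }
  destruct (Ceq_dec (sum_n (fun l => cis x ^ l)%C q) 0%C) as [E|E]; [exact E|].
  exfalso; exact (Cmult_neq_0 _ _ N E G).
Qed.

(** * Parseval's identity on equally spaced nodes *)

Definition trig_poly (a : nat -> C) (M : nat) (x : R) : C :=
  sum_n (fun n => a n * cis (INR n * x))%C M.

Lemma Cconj_cis (x : R) : Cconj (cis x) = cis (- x).
Proof. unfold Cconj, cis; simpl; now rewrite cos_neg, sin_neg. Qed.

Lemma sum_n_conj (a : nat -> C) (n : nat) :
  sum_n (fun k => Cconj (a k)) n = Cconj (sum_n a n).
Proof.
  induction n as [|n IH].
  - now rewrite !sum_O.
  - rewrite !sum_Sn, IH; change plus with Cplus; now rewrite Cplus_conj.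
Qed.

(** After exchanging the two sums, each coefficient [a n] meets a sum over the nodes at the
    frequency [S M - n], which lies between 1 and [q]. *)
Lemma trig_poly_orthogonal (a : nat -> C) (M q : nat) :
  (S M <= q)%nat ->
  sum_n (fun l => Cconj (cis (INR (S M) * node q l))
                  * trig_poly a M (node q l))%C q = RtoC 0.
Proof.
  intros HM.
  rewrite (sum_n_ext _ (fun l => sum_n (fun n =>
    a n * Cconj (cis (INR (S M - n) * node q l)))%C M)).
  2:{ intros l; unfold trig_poly.
      rewrite <- (sum_n_mult_l (K := C_Ring)).
      apply sum_n_ext_loc; intros n Hn; change mult with Cmult.
      rewrite minus_INR by lia.
      replace ((INR (S M) - INR n) * node q l)
        with (INR (S M) * node q l + - (INR n * node q l)) by ring.
      rewrite cis_plus, Cmult_conj, !Cconj_cis, Ropp_involutive; ring_C. }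
  rewrite sum_n_switch.
  rewrite (sum_n_ext_loc _ (fun _ => RtoC 0)).
  - induction M; [now rewrite sum_O|].
    rewrite sum_Sn, IHM by lia; change plus with Cplus; ring_C.
  - intros n Hn.
    rewrite (sum_n_mult_l (K := C_Ring)), sum_n_conj, sum_cis_node by lia.
    change mult with Cmult.
    apply C_eq; simpl; ring.
Qed.

Lemma Cmod_plus_sqr (z w : C) :
  Cmod (z + w) ^ 2 = Cmod z ^ 2 + Cmod w ^ 2 + 2 * Re (Cconj w * z)%C.
Proof. rewrite !Cmod2_alt; destruct z, w; simpl; ring. Qed.

Lemma Re_sum_n (a : nat -> C) (n : nat) :
  Re (sum_n a n) = sum_n (fun k => Re (a k)) n.
Proof.
  induction n as [|n IH].
  - now rewrite !sum_O.
  - rewrite !sum_Sn, <- IH; reflexivity.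
Qed.

Lemma Im_sum_n (a : nat -> C) (n : nat) :
  Im (sum_n a n) = sum_n (fun k => Im (a k)) n.
Proof.
  induction n as [|n IH].
  - now rewrite !sum_O.
  - rewrite !sum_Sn, <- IH; reflexivity.
Qed.

(** Averages over [q + 1] nodes replace integrals over the circle and are exact up to degree [q]. In
    the induction, the new top term adds its own squared modulus, and the cross term vanishes by
    orthogonality to all lower frequencies. *)
Lemma parseval_node (a : nat -> C) (M q : nat) :
  (M <= q)%nat ->
  sum_n (fun l => Cmod (trig_poly a M (node q l)) ^ 2) q
  = INR (S q) * sum_n (fun n => Cmod (a n) ^ 2) M.
Proof.
  induction M as [|M IH]; intros HM.
  - rewrite sum_O, <- (sum_n_const q (Cmod (a 0%nat) ^ 2)).
    apply sum_n_ext; intros l; unfold trig_poly.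
    rewrite sum_O, Cmod_mult, Cmod_cis, Rmult_1_r; reflexivity.
  - specialize (IH ltac:(lia)).
    rewrite (sum_n_ext _ (fun l =>
      plus (plus (Cmod (trig_poly a M (node q l)) ^ 2) (Cmod (a (S M)) ^ 2))
        (2 * Re (Cconj (a (S M)) * (Cconj (cis (INR (S M) * node q l))
                  * trig_poly a M (node q l)))%C))).
    2:{ intros l; unfold trig_poly at 1; rewrite sum_Sn.
        fold (trig_poly a M (node q l)).
        change plus with Cplus at 1.
        rewrite Cmod_plus_sqr, Cmod_mult, Cmod_cis, Rmult_1_r, Cmult_conj, Cmult_assoc.
        reflexivity. }
    rewrite !sum_n_plus, IH, sum_n_const, sum_Sn.
    rewrite (sum_n_mult_l (K := R_Ring) 2), <- Re_sum_n.
    rewrite (sum_n_mult_l (K := C_Ring) (Cconj (a (S M)))).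
    change (mult (K := C_Ring)) with Cmult.
    rewrite trig_poly_orthogonal by lia.
    rewrite Cmult_0_r.
    change plus with Rplus; change mult with Rmult; simpl (Re _); ring_R.
Qed.

(** * Tails of series and comparison of absolutely convergent Fourier series *)

Lemma norm_series_le {K : AbsRing} {V : NormedModule K} (a : nat -> V) (l : V) (s : R) :
  is_series a l -> is_series (fun n => norm (a n)) s -> norm l <= s.
Proof.
  intros Ha Hs.
  assert (H1 : is_lim_seq (fun n => norm (sum_n a n)) (norm l)).
  { exact (filterlim_comp _ _ _ (sum_n a) norm _ _ _ Ha (filterlim_norm l)). }
  apply (is_lim_seq_le (fun n => norm (sum_n a n))
           (sum_n (fun n => norm (a n))) (norm l) s); [|exact H1|exact Hs].
  intros n; apply norm_sum_n_m.
Qed.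

Lemma norm_series_tail_le {K : AbsRing} {V : NormedModule K}
    (a : nat -> V) (l : V) (s : R) (n : nat) :
  is_series a l -> is_series (fun n => norm (a n)) s ->
  norm (minus l (sum_n a n)) <= s - sum_n (fun n => norm (a n)) n.
Proof.
  intros Ha Hs.
  apply (norm_series_le (fun k => a (S n + k)%nat)).
  - apply is_series_incr_n; [lia|]; change (Init.Nat.pred (S n)) with n.
    assert (E : plus (minus l (sum_n a n)) (sum_n a n) = l).
    { unfold minus; now rewrite <- plus_assoc, plus_opp_l, plus_zero_r. }
    exact (eq_ind_r (fun y => is_series a y) Ha E).
  - apply (is_series_incr_n (fun n => norm (a n))); [lia|]; change (Init.Nat.pred (S n)) with n.
    refine (eq_ind_r (fun y => is_series (fun n => norm (a n)) y) Hs _).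
    assert (E : forall x y : R, x - y + y = x) by (intros; ring); apply E.
Qed.

Lemma sum_n_le (a b : nat -> R) (n : nat) :
  (forall k, (k <= n)%nat -> a k <= b k) -> sum_n a n <= sum_n b n.
Proof.
  intros H; rewrite !sum_n_Reals; apply sum_Rle; exact H.
Qed.

(* Absolutely convergent Fourier series, supported on the nonnegative frequencies. *)
Definition is_fourier (a : nat -> C) (p : R -> C) : Prop :=
  ex_series (fun n => Cmod (a n)) /\
  forall x, @is_series C_AbsRing C_NormedModule
              (fun n => a n * cis (INR n * x))%C (p x).

(** The bound is uniform in [x], so it can be applied at nodes that change with [M]. *)
Lemma is_fourier_tail (a : nat -> C) (p : R -> C) (M : nat) (x : R) :
  is_fourier a p ->
  Cmod (p x - trig_poly a M x)
  <= Series (fun n => Cmod (a n)) - sum_n (fun n => Cmod (a n)) M.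
Proof.
  intros [Ha Hp].
  pose proof (norm_series_tail_le (fun n => a n * cis (INR n * x))%C (p x)
    (Series (fun n => Cmod (a n))) M (Hp x)) as H.
  rewrite (sum_n_ext (G := R_AbelianMonoid) _ (fun n => Cmod (a n))) in H.
  - apply H.
    apply (is_series_ext (fun n => Cmod (a n))); [|now apply Series_correct].
    intros n; change (Cmod (a n) = Cmod (a n * cis (INR n * x))%C).
    now rewrite Cmod_mult, Cmod_cis, Rmult_1_r.
  - intros n; change (Cmod (a n * cis (INR n * x))%C = Cmod (a n)).
    now rewrite Cmod_mult, Cmod_cis, Rmult_1_r.
Qed.

Lemma sum_n_le_Series (a : nat -> R) (n : nat) :
  (forall k, 0 <= a k) -> ex_series a -> sum_n a n <= Series a.
Proof.
  intros Hp Ha.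
  apply (is_lim_seq_incr_compare (sum_n a)).
  - exact (Series_correct a Ha).
  - intros k; rewrite sum_Sn; change plus with Rplus; specialize (Hp (S k)); lra.
Qed.

Lemma trig_poly_bound (a : nat -> C) (M : nat) (x : R) :
  Cmod (trig_poly a M x) <= sum_n (fun n => Cmod (a n)) M.
Proof.
  unfold trig_poly.
  eapply Rle_trans; [apply (norm_sum_n_m (V := C_NormedModule))|].
  apply sum_n_le; intros n _.
  change (Cmod (a n * cis (INR n * x))%C <= Cmod (a n)).
  rewrite Cmod_mult, Cmod_cis; lra.
Qed.

(** Truncating both series at [M] costs an error uniform in [x], so the pointwise inequality and the
    finite Parseval identity compare the sums of squares up to [M], with an error tending to 0.
    Since [b] is dominated by [a] beyond [N], the difference of these sums is smallest at [N], among
    all [M >= N]. *)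
Lemma parseval_compare (a b : nat -> C) (pa pb : R -> C) (N : nat) :
  is_fourier a pa -> is_fourier b pb ->
  (forall x, Cmod (pa x) <= Cmod (pb x)) ->
  (forall n, (N < n)%nat -> Cmod (b n) <= Cmod (a n)) ->
  sum_n (fun n => Cmod (a n) ^ 2) N <= sum_n (fun n => Cmod (b n) ^ 2) N.
Proof.
  intros Fa Fb Hle Htail.
  set (As := Series (fun n => Cmod (a n))).
  set (Bs := Series (fun n => Cmod (b n))).
  set (dl := fun M => (As - sum_n (fun n => Cmod (a n)) M)
                      + (Bs - sum_n (fun n => Cmod (b n)) M)).
  assert (Hdl : is_lim_seq dl 0).
  { assert (K : forall c : nat -> C, ex_series (fun n => Cmod (c n)) ->
       is_lim_seq (fun M => Series (fun n => Cmod (c n))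
                            - sum_n (fun n => Cmod (c n)) M) 0).
    { intros c Hc.
      replace 0 with (Series (fun n => Cmod (c n)) - Series (fun n => Cmod (c n)))
        by ring.
      apply is_lim_seq_minus'; [apply is_lim_seq_const|].
      exact (Series_correct _ Hc). }
    replace 0 with (0 + 0) by ring.
    apply is_lim_seq_plus'; apply K; [apply Fa|apply Fb]. }
  (* Adding [dl M] to a nonnegative number at most [Bs] increases its square by at most this
     amount. *)
  assert (Hlim : is_lim_seq (fun M => 2 * Bs * dl M + dl M * dl M) 0).
  { replace 0 with (2 * Bs * 0 + 0 * 0) by ring.
    apply is_lim_seq_plus'.
    - now apply (is_lim_seq_scal_l dl (2 * Bs) 0).
    - now apply is_lim_seq_mult'. }
  assert (HB : forall M, sum_n (fun n => Cmod (b n)) M <= Bs).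
  { intros M; apply sum_n_le_Series; [intros; apply Cmod_ge_0|apply Fb]. }
  assert (HA : forall M, sum_n (fun n => Cmod (a n)) M <= As).
  { intros M; apply sum_n_le_Series; [intros; apply Cmod_ge_0|apply Fa]. }
  assert (Hd0 : forall M, 0 <= dl M).
  { intros M; unfold dl; specialize (HA M); specialize (HB M); lra. }
  assert (Hpt : forall M x,
    Cmod (trig_poly a M x) ^ 2
    <= Cmod (trig_poly b M x) ^ 2 + (2 * Bs * dl M + dl M * dl M)).
  { intros M x.
    pose proof (is_fourier_tail a pa M x Fa) as Ta.
    pose proof (is_fourier_tail b pb M x Fb) as Tb.
    fold As in Ta; fold Bs in Tb.
    assert (H1 : Cmod (trig_poly a M x) <= Cmod (pa x) + Cmod (pa x - trig_poly a M x)).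
    { rewrite <- (Cmod_opp (pa x - _)).
      eapply Rle_trans; [|apply Cmod_triangle].
      right; f_equal; ring. }
    assert (H2 : Cmod (pb x) <= Cmod (trig_poly b M x) + Cmod (pb x - trig_poly b M x)).
    { eapply Rle_trans; [|apply Cmod_triangle].
      right; f_equal; ring. }
    pose proof (trig_poly_bound b M x) as Hb.
    specialize (HB M); specialize (Hle x); specialize (Hd0 M).
    pose proof (Cmod_ge_0 (trig_poly a M x)).
    pose proof (Cmod_ge_0 (trig_poly b M x)).
    assert (H3 : Cmod (trig_poly a M x) <= Cmod (trig_poly b M x) + dl M)
      by (unfold dl; lra).
    assert (Cmod (trig_poly a M x) ^ 2 <= (Cmod (trig_poly b M x) + dl M) ^ 2)
      by (apply pow_incr; lra).
    nra. }
  assert (HM : forall M,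
    sum_n (fun n => Cmod (a n) ^ 2) M
    <= sum_n (fun n => Cmod (b n) ^ 2) M + (2 * Bs * dl M + dl M * dl M)).
  { intros M.
    (* Parseval is used with exactly [M + 1] nodes, for both polynomials, so the factor [INR (S M)]
       is common. *)
    assert (HS : 0 < INR (S M)) by (apply lt_0_INR; lia).
    apply (Rmult_le_reg_l (INR (S M))); [assumption|].
    rewrite Rmult_plus_distr_l, <- !(parseval_node _ M M) by lia.
    rewrite <- sum_n_const.
    rewrite <- (sum_n_plus (G := R_AbelianMonoid)).
    apply sum_n_le; intros l _; apply Hpt. }
  assert (Hmono : forall M, (N <= M)%nat ->
    sum_n (fun n => Cmod (a n) ^ 2) N - sum_n (fun n => Cmod (b n) ^ 2) N
    <= sum_n (fun n => Cmod (a n) ^ 2) M - sum_n (fun n => Cmod (b n) ^ 2) M).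
  { intros M HNM; induction HNM as [|M HNM IH]; [lra|].
    rewrite !sum_Sn; change plus with Rplus.
    assert (Cmod (b (S M)) ^ 2 <= Cmod (a (S M)) ^ 2).
    { apply pow_incr; split; [apply Cmod_ge_0|apply Htail; lia]. }
    lra. }
  assert (Hfin : Rbar_le
    (sum_n (fun n => Cmod (a n) ^ 2) N - sum_n (fun n => Cmod (b n) ^ 2) N) 0).
  { eapply is_lim_seq_le_loc; [|apply is_lim_seq_const|exact Hlim].
    exists N; intros M HNM; specialize (HM M); specialize (Hmono M HNM); lra. }
  unfold Rbar_le in Hfin; lra.
Qed.

(** * Sums, multiples and shifts of Fourier series *)

Lemma is_series_decr_zeros {K : AbsRing} {V : NormedModule K}
    (a : nat -> V) (N : nat) (l : V) :
  (forall n, (n < N)%nat -> a n = zero) ->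
  is_series (fun k => a (N + k)%nat) l -> is_series a l.
Proof.
  intros Hz H.
  destruct N as [|N]; [exact H|].
  apply (is_series_decr_n a (S N)); [lia|].
  assert (E : sum_n a (Init.Nat.pred (S N)) = zero).
  { change (Init.Nat.pred (S N)) with N.
    rewrite (sum_n_ext_loc _ (fun _ => zero)) by (intros; apply Hz; lia).
    apply sum_n_m_const_zero. }
  assert (E' : plus l (opp (sum_n a (Init.Nat.pred (S N)))) = l).
  { rewrite E.
    transitivity (minus l zero); [reflexivity|apply minus_zero_r]. }
  exact (eq_ind_r (fun y => is_series _ y) H E').
Qed.

Lemma is_fourier_plus (a b : nat -> C) (p q : R -> C) :
  is_fourier a p -> is_fourier b q ->
  is_fourier (fun n => a n + b n)%C (fun x => p x + q x)%C.
Proof.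
  intros [Ha1 Ha2] [Hb1 Hb2]; split.
  - apply (ex_series_le (V := R_CompleteNormedModule) (fun n => Cmod (a n + b n))
             (fun n => Cmod (a n) + Cmod (b n))).
    + intros n; change (Rabs (Cmod (a n + b n)) <= Cmod (a n) + Cmod (b n)).
      rewrite Rabs_pos_eq by apply Cmod_ge_0; apply Cmod_triangle.
    + now apply (ex_series_plus (fun n => Cmod (a n)) (fun n => Cmod (b n))).
  - intros x.
    apply (is_series_ext (fun n => plus (a n * cis (INR n * x))%C
                                        (b n * cis (INR n * x))%C)).
    + intros n; change plus with Cplus; ring_C.
    + apply (is_series_plus (V := C_NormedModule)); auto.
Qed.

Lemma is_fourier_scal (c : C) (a : nat -> C) (p : R -> C) :
  is_fourier a p -> is_fourier (fun n => c * a n)%C (fun x => c * p x)%C.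
Proof.
  intros [Ha1 Ha2]; split.
  - apply (ex_series_ext (fun n => scal (Cmod c) (Cmod (a n)))).
    + intros n; rewrite Cmod_mult; reflexivity.
    + now apply (ex_series_scal (V := R_NormedModule) (Cmod c)).
  - intros x.
    apply (is_series_ext (fun n => scal c (a n * cis (INR n * x))%C)).
    + intros n; apply Cmult_assoc.
    + apply (is_series_scal (V := C_NormedModule)); auto.
Qed.

Definition shift (N : nat) (a : nat -> C) (n : nat) : C :=
  if (n <? N)%nat then RtoC 0 else a (n - N)%nat.

Lemma shift_lt (N n : nat) (a : nat -> C) : (n < N)%nat -> shift N a n = RtoC 0.
Proof.
  intros H; unfold shift; now rewrite (proj2 (Nat.ltb_lt n N) H).
Qed.

Lemma shift_add (N k : nat) (a : nat -> C) : shift N a (N + k)%nat = a k.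
Proof.
  unfold shift; rewrite (proj2 (Nat.ltb_ge (N + k) N)) by lia; f_equal; lia.
Qed.

Lemma shift_diag (N : nat) (a : nat -> C) : shift N a N = a 0%nat.
Proof. rewrite <- (shift_add N 0 a), Nat.add_0_r; reflexivity. Qed.

Lemma is_fourier_shift (N : nat) (a : nat -> C) (p : R -> C) :
  is_fourier a p ->
  is_fourier (shift N a) (fun x => cis (INR N * x) * p x)%C.
Proof.
  intros [[s Ha1] Ha2]; split.
  - exists s; apply (is_series_decr_zeros _ N).
    + intros n Hn; rewrite shift_lt by exact Hn; apply Cmod_0.
    + apply (is_series_ext (fun n => Cmod (a n))); [|exact Ha1].
      intros n; now rewrite shift_add.
  - intros x; apply (is_series_decr_zeros _ N).
    + intros n Hn; rewrite shift_lt by exact Hn; apply Cmult_0_l.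
    + apply (is_series_ext (fun n => scal (cis (INR N * x)) (a n * cis (INR n * x))%C)).
      * intros n; rewrite shift_add, plus_INR, Rmult_plus_distr_r, cis_plus.
        change scal with Cmult; ring_C.
      * apply (is_series_scal (V := C_NormedModule)); auto.
Qed.

Definition delta0 (n : nat) : C := if (n =? 0)%nat then RtoC 1 else RtoC 0.

Lemma is_fourier_delta0 : is_fourier delta0 (fun _ => RtoC 1).
Proof.
  assert (Z : forall {K : AbsRing} {V : NormedModule K} (a : nat -> V) (l : V),
    a 0%nat = l -> (forall n, a (S n) = zero) -> is_series a l).
  { intros K V a l H0 HS.
    apply filterlim_ext with (fun _ : nat => l).
    - intros n; induction n as [|n IH]; [now rewrite sum_O|].
      now rewrite sum_Sn, <- IH, HS, plus_zero_r.
    - apply filterlim_const. }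
  split.
  - exists 1; apply Z; [apply Cmod_1|intros n; apply Cmod_0].
  - intros x; apply Z.
    + change (RtoC 1 * cis (INR 0 * x) = RtoC 1)%C.
      rewrite Rmult_0_l, cis_0; ring.
    + intros n; apply Cmult_0_l.
Qed.

(** * Clunie's coefficient inequality *)

Lemma clunie_step (c : nat -> C) (g : R -> C) (D : C) (B : R) (p : nat) :
  is_fourier c g -> c 0%nat = RtoC 0 -> D <> RtoC 0 -> -1 <= B <= 1 ->
  (forall x, Cmod (g x) <= Cmod (D - RtoC B * g x)%C) ->
  sum_n (fun n => Cmod (c n) ^ 2) (S p)
  <= Cmod D ^ 2 + B ^ 2 * sum_n (fun n => Cmod (c n) ^ 2) p.
Proof.
  intros Hc c0 HD HB Hle.
  (* The coefficient of index [S p] of [b] is [D * beta - B * c (S p)], and this choice makes it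
     zero. *)
  set (beta := (RtoC B * c (S p) / D)%C).
  set (a := fun n => (c n + beta * shift (S p) c n)%C).
  set (b := fun n => (D * (delta0 n + beta * shift (S p) delta0 n)
                      + RtoC (- B) * a n)%C).
  assert (Fa : is_fourier a (fun x => g x + beta * (cis (INR (S p) * x) * g x))%C).
  { apply is_fourier_plus; [exact Hc|].
    now apply is_fourier_scal, is_fourier_shift. }
  assert (Fb : is_fourier b (fun x =>
      D * (RtoC 1 + beta * (cis (INR (S p) * x) * RtoC 1))
      + RtoC (- B) * (g x + beta * (cis (INR (S p) * x) * g x)))%C).
  { apply is_fourier_plus; apply is_fourier_scal; [|exact Fa].
    apply is_fourier_plus; [exact is_fourier_delta0|].
    now apply is_fourier_scal, is_fourier_shift, is_fourier_delta0. }
  (* The shifted copy of [c] starts at index [S p] with the value [c 0 = 0], so even the coefficient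
     of index [S p] is unchanged. *)
  assert (alow : forall n, (n <= S p)%nat -> a n = c n).
  { intros n Hn; unfold a.
    destruct (Nat.eq_dec n (S p)) as [->|Hne].
    - rewrite shift_diag, c0; ring.
    - rewrite shift_lt by lia; ring. }
  assert (b0 : b 0%nat = D).
  { unfold b; rewrite (alow 0%nat), c0, shift_lt by lia; unfold delta0; simpl; ring. }
  assert (bmid : forall n, (0 < n < S p)%nat -> b n = (RtoC (- B) * c n)%C).
  { intros n Hn; unfold b; rewrite (alow n), shift_lt by lia.
    unfold delta0; rewrite (proj2 (Nat.eqb_neq n 0)) by lia; ring. }
  assert (blast : b (S p) = RtoC 0).
  { unfold b; rewrite (alow (S p)) by lia.
    rewrite shift_diag.
    unfold delta0; simpl (S p =? 0)%nat; simpl (0 =? 0)%nat; cbv iota.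
    rewrite RtoC_opp; unfold beta; field; exact HD. }
  assert (bhigh : forall n, (S p < n)%nat -> b n = (RtoC (- B) * a n)%C).
  { intros n Hn; unfold b.
    assert (E : shift (S p) delta0 n = delta0 (n - S p)).
    { rewrite <- (shift_add (S p) (n - S p) delta0); f_equal; lia. }
    rewrite E.
    (* The part of [b] with factor [D] lives at the indices 0 and [S p] only. *)
    unfold delta0; rewrite (proj2 (Nat.eqb_neq n 0)) by lia.
    rewrite (proj2 (Nat.eqb_neq (n - S p) 0)) by lia; ring. }
  assert (HcB : forall z, Cmod (RtoC (- B) * z)%C = Rabs B * Cmod z).
  { intros z; now rewrite Cmod_mult, Cmod_R, Rabs_Ropp. }
  assert (HB1 : Rabs B <= 1) by (apply Rabs_le; lra).
  pose proof (parseval_compare a b _ _ (S p) Fa Fb) as P.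
  rewrite (sum_n_ext_loc (G := R_AbelianMonoid) (fun n => Cmod (a n) ^ 2)
             (fun n => Cmod (c n) ^ 2)) in P
    by (intros n Hn; now rewrite alow).
  eapply Rle_trans; [apply P|].
  - intros x.
    (* Both functions are the original ones times the same factor, so the pointwise hypothesis
       carries over. *)
    replace (g x + _)%C with ((1 + beta * cis (INR (S p) * x)) * g x)%C by ring.
    replace (D * _ + _)%C
      with ((1 + beta * cis (INR (S p) * x)) * (D - RtoC B * g x))%C
      by (rewrite RtoC_opp; ring).
    rewrite !Cmod_mult.
    apply Rmult_le_compat_l; [apply Cmod_ge_0|apply Hle].
  - intros n Hn; rewrite bhigh, HcB by exact Hn.
    pose proof (Cmod_ge_0 (a n)); nra.
  - rewrite sum_Sn, blast, Cmod_0; change plus with Rplus.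
    assert (E : forall k, (k <= p)%nat ->
      sum_n (fun n => Cmod (b n) ^ 2) k
      = Cmod D ^ 2 + B ^ 2 * sum_n (fun n => Cmod (c n) ^ 2) k).
    { induction k as [|k IH]; intros Hk.
      - rewrite !sum_O, b0, c0, Cmod_0; ring_R.
      - rewrite !sum_Sn, IH, bmid, HcB by lia; change plus with Rplus.
        rewrite Rpow_mult_distr, pow2_abs; ring_R. }
    rewrite E by lia; right; ring_R.
Qed.

(** * Series expansion of the logarithmic derivative *)

Lemma is_series_C (u : nat -> C) (l : C) :
  @is_series C_AbsRing C_NormedModule u l <->
  is_series (fun n => Re (u n)) (Re l) /\ is_series (fun n => Im (u n)) (Im l).
Proof.
  split.
  - intros H; split; intros P [eps HP].
    + assert (Q : locally (T := C_NormedModule) l (fun z : C => P (Re z))).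
      { exists eps; intros z [Hz _]; now apply HP. }
      specialize (H _ Q); unfold filtermap in *.
      revert H; apply filter_imp; intros n; now rewrite <- Re_sum_n.
    + assert (Q : locally (T := C_NormedModule) l (fun z : C => P (Im z))).
      { exists eps; intros z [_ Hz]; now apply HP. }
      specialize (H _ Q); unfold filtermap in *.
      revert H; apply filter_imp; intros n; now rewrite <- Im_sum_n.
  - intros [Hr Hi] P [eps HP].
    destruct (Hr (ball (Re l) eps) (locally_ball (Re l) eps)) as [N1 H1].
    destruct (Hi (ball (Im l) eps) (locally_ball (Im l) eps)) as [N2 H2].
    exists (Nat.max N1 N2); intros n Hn; apply HP; split.
    + specialize (H1 n ltac:(lia)); now rewrite <- Re_sum_n in H1.
    + specialize (H2 n ltac:(lia)); now rewrite <- Im_sum_n in H2.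
Qed.

(* Complex differentiability is only used along the ray [s |-> s z] at [s = 1],
   which reduces the term-by-term differentiation to real power series. *)
Lemma is_derive_ray (f : C -> C) (z l : C) :
  @is_derive C_AbsRing C_NormedModule f z l ->
  is_derive (fun s : R => Re (f (RtoC s * z)%C)) 1 (Re (z * l)%C) /\
  is_derive (fun s : R => Im (f (RtoC s * z)%C)) 1 (Im (z * l)%C).
Proof.
  intros [_ H].
  specialize (H z (fun P HP => HP)).
  assert (K : forall eps : posreal, exists delta : posreal, forall h : R,
    Rabs h < delta ->
    Cmod (f (RtoC (1 + h) * z) - f (RtoC 1 * z) - RtoC h * (z * l))%C
    <= eps * Rabs h).
  { intros eps.
    pose proof (Cmod_ge_0 z) as Hz.
    (* The increment of the argument is [h z], of modulus [|h| |z|]. Dividing by [Cmod z + 1]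
       compensates for the factor [|z|] and is legitimate at [z = 0] too. *)
    assert (He : 0 < eps / (Cmod z + 1))
      by (apply Rdiv_lt_0_compat; [apply cond_pos|lra]).
    destruct (H (mkposreal _ He)) as [delta Hd].
    assert (Hd' : 0 < delta / (Cmod z + 1))
      by (apply Rdiv_lt_0_compat; [apply cond_pos|lra]).
    exists (mkposreal _ Hd'); simpl; intros h Hh.
    assert (Hy : Cmod (RtoC (1 + h) * z - z)%C = Rabs h * Cmod z).
    { rewrite <- Cmod_R, <- Cmod_mult; f_equal; rewrite RtoC_plus; ring. }
    assert (Hh' : Rabs h * (Cmod z + 1) < delta).
    { apply (Rmult_lt_compat_r (Cmod z + 1)) in Hh; [|lra].
      unfold Rdiv in Hh; rewrite Rmult_assoc, Rinv_l in Hh; lra. }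
    pose proof (Rabs_pos h) as Hp.
    specialize (Hd (RtoC (1 + h) * z)%C).
    match type of Hd with ?X -> _ => assert (HX : X) end.
    { change (Cmod (RtoC (1 + h) * z - z)%C < delta); rewrite Hy; lra. }
    specialize (Hd HX).
    change (Cmod (f (RtoC (1 + h) * z) - f z - (RtoC (1 + h) * z - z) * l)%C
       <= eps / (Cmod z + 1) * Cmod (RtoC (1 + h) * z - z)%C) in Hd.
    rewrite Hy in Hd.
    rewrite Cmult_1_l.
    replace (RtoC h * (z * l))%C with ((RtoC (1 + h) * z - z) * l)%C
      by (rewrite RtoC_plus; ring).
    eapply Rle_trans; [exact Hd|].
    replace (eps / (Cmod z + 1) * (Rabs h * Cmod z))
      with (eps * Rabs h * (Cmod z / (Cmod z + 1))) by (field; lra).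
    rewrite <- (Rmult_1_r (eps * Rabs h)) at 2.
    apply Rmult_le_compat_l.
    - apply Rmult_le_pos; [apply Rlt_le, cond_pos|exact Hp].
    - apply (Rmult_le_reg_r (Cmod z + 1)); [lra|].
      unfold Rdiv; rewrite Rmult_assoc, Rinv_l; lra. }
  (* Real and imaginary parts are treated at once: all that matters is that the real remainder is
     dominated by the complex one. *)
  assert (T : forall (F : R -> R) (v : R),
    (forall h, Rabs (F (1 + h) - F 1 - h * v)
      <= Cmod (f (RtoC (1 + h) * z) - f (RtoC 1 * z) - RtoC h * (z * l))%C) ->
    is_derive F 1 v).
  { intros F v HF; apply is_derive_Reals; intros eps Heps.
    (* Halving [eps] turns the weak inequality of [K] into the strict one required here. *)
    assert (He : 0 < eps / 2) by lra.
    destruct (K (mkposreal _ He)) as [delta Hd]; simpl in Hd.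
    exists delta; intros h Hh0 Hh.
    assert (Hp : 0 < Rabs h) by now apply Rabs_pos_lt.
    replace ((F (1 + h) - F 1) / h - v) with ((F (1 + h) - F 1 - h * v) / h)
      by (field; exact Hh0).
    unfold Rdiv; rewrite Rabs_mult, Rabs_inv.
    apply (Rmult_lt_reg_r (Rabs h)); [exact Hp|].
    rewrite Rmult_assoc, Rinv_l by lra.
    specialize (HF h); specialize (Hd h Hh); nra. }
  split; apply T; intros h;
    generalize (f (RtoC (1 + h) * z)%C) (f (RtoC 1 * z)%C) (z * l)%C;
    intros u v w; destruct u, v, w.
  - eapply Rle_trans; [|apply re_le_Cmod].
    right; f_equal; simpl; ring.
  - rewrite <- (Cmod_R (_ - _)).
    eapply Rle_trans; [|eapply Rle_trans; [apply Rmax_r|apply Rmax_Cmod]].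
    rewrite Cmod_R; right; f_equal; simpl; ring.
Qed.

Lemma CV_radius_gt_1 (b : nat -> R) (rho M : R) :
  1 < rho -> (forall n, Rabs (b n * rho ^ n) <= M) ->
  Rbar_lt (Rabs 1) (CV_radius b).
Proof.
  intros Hr HM; rewrite Rabs_R1.
  apply Rbar_lt_le_trans with (Finite rho); [exact Hr|].
  apply CV_radius_bounded; now exists M.
Qed.

Lemma is_series_terms_bounded (u : nat -> C) (l : C) :
  @is_series C_AbsRing C_NormedModule u l ->
  exists M, forall n, Cmod (u n) <= M.
Proof.
  intros H; apply is_series_C in H; destruct H as [Hr Hi].
  assert (T : forall v : nat -> R, ex_series v -> exists M, forall n, Rabs (v n) <= M).
  { intros v Hv; apply ex_series_lim_0 in Hv.
    apply is_lim_seq_Reals in Hv.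
    destruct (maj_by_pos v (exist _ 0 Hv)) as [M [_ HM]]; now exists M. }
  destruct (T _ (ex_intro _ _ Hr)) as [M1 H1].
  destruct (T _ (ex_intro _ _ Hi)) as [M2 H2].
  exists (M1 + M2); intros n.
  replace (u n) with (RtoC (Re (u n)) + Ci * RtoC (Im (u n)))%C
    by (apply C_eq; simpl; ring).
  eapply Rle_trans; [apply Cmod_triangle|].
  rewrite Cmod_mult, Cmod_Ci, !Cmod_R, Rmult_1_l.
  specialize (H1 n); specialize (H2 n); lra.
Qed.

(** The term of index 0 vanishes, and the others are those of [PS_derive b] at 1, a point inside the
    disc of convergence. *)
Lemma is_series_derive_1 (b : nat -> R) :
  Rbar_lt (Rabs 1) (CV_radius b) ->
  is_series (fun n => INR n * b n) (Derive (PSeries b) 1).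
Proof.
  intros H; apply is_series_decr_1.
  rewrite Rmult_0_l.
  match goal with |- is_series _ ?x => replace x with (Derive (PSeries b) 1) end.
  2:{ change plus with Rplus; change opp with Ropp; ring_R. }
  apply (is_series_ext (fun n => PS_derive b n * 1 ^ n)).
  - intros n; rewrite pow1; apply Rmult_1_r.
  - apply is_pseries_R, is_pseries_derive, H.
Qed.

Lemma ex_series_abs_derive_1 (b : nat -> R) :
  Rbar_lt (Rabs 1) (CV_radius b) ->
  ex_series (fun n => Rabs (INR n * b n)).
Proof.
  intros H; apply ex_series_incr_1.
  apply (ex_series_ext (fun n => Rabs (PS_derive b n * 1 ^ n))).
  - intros n; rewrite pow1; f_equal; apply Rmult_1_r.
  - apply CV_disk_inside; now rewrite CV_radius_derive.
Qed.

(** Along the ray through [z], [L (s z)] is a power series in [s ^ m] that converges beyond [s = 1].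
    It may thus be differentiated term by term at 1, and differentiating
    [f (s z) = s z exp (L (s z))] there gives the expansion of [z f'(z) / f(z)]. *)
Lemma log_derivative_series (m : nat) (f L : C -> C) (d : nat -> C) (z : C) :
  (1 <= m)%nat -> analytic_on_disc f ->
  (forall z, unit_disc z -> z <> RtoC 0 -> Cexp (L z) = (f z / z)%C) ->
  (forall z, unit_disc z -> exists s : C,
     is_csum1 (fun n => d (n * m)%nat * z ^ (n * m))%C s /\ L z = (2 * s)%C) ->
  unit_disc z -> z <> RtoC 0 -> f z <> RtoC 0 ->
  let u := fun n => (RtoC (2 * INR n * INR m) * d (n * m)%nat * z ^ (n * m))%C in
  ex_series (fun n => Cmod (u n)) /\
  @is_series C_AbsRing C_NormedModule u (zf'_over_f f z - 1)%C.
Proof.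
  intros Hm Hf HL Hser Hz Hz0 Hfz u.
  assert (Hzp : 0 < Cmod z) by now apply Cmod_gt_0.
  unfold unit_disc in Hz.
  (* Index 0 is set to zero, so that the expansion of [L], which starts at index 1, becomes a series
     over all [n]. *)
  set (b := fun n => if (n =? 0)%nat then RtoC 0 else (2 * (d (n * m)%nat * z ^ (n * m)))%C).
  (* Since [|z| < 1], this dilation satisfies [s0 > 1] and still keeps [s0 z] in the disc. *)
  set (s0 := 2 / (1 + Cmod z)).
  assert (Hs01 : 1 < s0).
  { unfold s0; apply (Rmult_lt_reg_r (1 + Cmod z)); [lra|].
    unfold Rdiv; rewrite Rmult_assoc, Rinv_l; lra. }
  assert (Hs0z : s0 * Cmod z < 1).
  { unfold s0; apply (Rmult_lt_reg_r (1 + Cmod z)); [lra|].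
    replace (2 / (1 + Cmod z) * Cmod z * (1 + Cmod z)) with (2 * Cmod z)
      by (field; lra); lra. }
  assert (Hdisc : forall s, 0 <= s <= s0 -> unit_disc (RtoC s * z)%C).
  { intros s Hs; unfold unit_disc; rewrite Cmod_mult, Cmod_R, Rabs_pos_eq by lra; nra. }
  assert (HLs : forall s, 0 <= s <= s0 ->
    @is_series C_AbsRing C_NormedModule
      (fun n => RtoC ((s ^ m) ^ n) * b n)%C (L (RtoC s * z)%C)).
  { intros s Hs; destruct (Hser _ (Hdisc s Hs)) as [w [Hw ->]].
    apply is_series_decr_1.
    match goal with |- is_series _ ?x => replace x with (2 * w)%C end.
    2:{ unfold b; simpl (0 =? 0)%nat; cbv iota; change plus with Cplus;
        change opp with Copp; ring_C. }
    apply (is_series_ext (fun n => scal (RtoC 2)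
       (d (S n * m)%nat * (RtoC s * z) ^ (S n * m))%C)).
    - intros n; change scal with Cmult.
      unfold b; change (S n =? 0)%nat with false; cbv iota.
      rewrite Cpow_mult_l, <- pow_mult, (Nat.mul_comm m (S n)), RtoC_pow; ring_C.
    - apply (is_series_scal (V := C_NormedModule)); exact Hw. }
  (* In the variable [s ^ m] the series converges at [s0 ^ m > 1]. Its terms are bounded there,
     which puts 1 strictly inside the disc of convergence for the real parts, imaginary parts and
     moduli of [b]. *)
  assert (Hrho : 1 < s0 ^ m) by (apply Rlt_pow_R1; [lra|lia]).
  destruct (is_series_terms_bounded _ _ (HLs s0 ltac:(lra))) as [M HM].
  assert (HMb : forall n, Cmod (b n) * (s0 ^ m) ^ n <= M).
  { intros n; specialize (HM n); rewrite Cmod_mult, Cmod_R, Rabs_pos_eq in HM.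
    - lra.
    - apply pow_le; lra. }
  assert (CVc : forall v : nat -> R, (forall n, Rabs (v n) <= Cmod (b n)) ->
    Rbar_lt (Rabs 1) (CV_radius v)).
  { intros v Hv; apply (CV_radius_gt_1 v (s0 ^ m) M Hrho).
    intros n; rewrite Rabs_mult, (Rabs_pos_eq (_ ^ n)) by (apply pow_le; lra).
    eapply Rle_trans; [|apply (HMb n)].
    apply Rmult_le_compat_r; [apply pow_le; lra|apply Hv]. }
  assert (CVr : Rbar_lt (Rabs 1) (CV_radius (fun n => Re (b n))))
    by (apply CVc; intros; apply re_le_Cmod).
  assert (CVi : Rbar_lt (Rabs 1) (CV_radius (fun n => Im (b n)))).
  { apply CVc; intros n; eapply Rle_trans; [apply Rmax_r|apply Rmax_Cmod]. }
  assert (CVm : Rbar_lt (Rabs 1) (CV_radius (fun n => Cmod (b n)))).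
  { apply CVc; intros n; rewrite Rabs_pos_eq by apply Cmod_ge_0; lra. }
  set (U := PSeries (fun n => Re (b n))) in *.
  set (V := PSeries (fun n => Im (b n))) in *.
  assert (HUV : forall s, 0 <= s <= s0 -> L (RtoC s * z)%C = (U (s ^ m), V (s ^ m))).
  { intros s Hs; pose proof (HLs s Hs) as Q; apply is_series_C in Q.
    destruct Q as [Qr Qi]; apply C_eq; simpl; symmetry; apply is_pseries_unique;
      apply is_pseries_R.
    - eapply is_series_ext; [|exact Qr]; intros n; cbv beta; rewrite re_scal_l; apply Rmult_comm.
    - eapply is_series_ext; [|exact Qi]; intros n; cbv beta; rewrite im_scal_l; apply Rmult_comm. }
  assert (Hfs : forall s, 0 < s <= s0 ->
    f (RtoC s * z)%C = (RtoC s * z * Cexp (U (s ^ m)%R, V (s ^ m)%R))%C).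
  { intros s Hs; rewrite <- HUV by lra.
    assert (N : (RtoC s * z)%C <> RtoC 0).
    { apply Cmult_neq_0; [|exact Hz0]; intros E; apply RtoC_inj in E; lra. }
    rewrite HL by (assumption || (apply Hdisc; lra)).
    field; split; [exact Hz0|intros E; apply RtoC_inj in E; lra]. }
  assert (Hloc : locally 1 (fun s : R => 0 < s <= s0)).
  { assert (He : 0 < Rmin 1 (s0 - 1)) by (apply Rmin_pos; lra).
    exists (mkposreal _ He); intros s Hs.
    change (Rabs (s - 1) < Rmin 1 (s0 - 1)) in Hs.
    apply Rabs_def2 in Hs.
    pose proof (Rmin_l 1 (s0 - 1)); pose proof (Rmin_r 1 (s0 - 1)); lra. }
  assert (EU : ex_derive U (1 ^ m)) by (rewrite pow1; now apply ex_derive_PSeries).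
  assert (EV : ex_derive V (1 ^ m)) by (rewrite pow1; now apply ex_derive_PSeries).
  (* This is the derivative of [L (s z)] in [s] at 1; the factor [m] comes from the inner function
     [s ^ m]. *)
  set (g := (INR m * Derive U 1, INR m * Derive V 1) : C).
  (* The derivative of [f (s z)] at [s = 1] is computed twice: by complex differentiability along
     the ray, and from the formula [Hfs], valid for [s] near 1. *)
  assert (Hder : (z * C_derive f z)%C = (f z * (1 + g))%C).
  { assert (Hd : @is_derive C_AbsRing C_NormedModule f z (C_derive f z))
      by (apply C_derive_correct; [exact z|apply Hf, Hz]).
    apply is_derive_ray in Hd; destruct Hd as [Dr Di].
    pose proof (Hfs 1 ltac:(lra)) as F1.
    rewrite Cmult_1_l, pow1 in F1.
    apply C_eq.
    - rewrite <- (is_derive_unique _ _ _ Dr).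
      apply is_derive_unique.
      apply (is_derive_ext_loc (fun s => Re (RtoC s * z * Cexp (U (s ^ m)%R, V (s ^ m)%R))%C)).
      + revert Hloc; apply filter_imp; intros s Hs; now rewrite Hfs.
      + rewrite F1; unfold Cexp, g; destruct z as [x y]; simpl.
        auto_derive; [tauto|].
        change (fun x : R => U x) with U; change (fun x : R => V x) with V.
        rewrite !pow1; ring_R.
    - rewrite <- (is_derive_unique _ _ _ Di).
      apply is_derive_unique.
      apply (is_derive_ext_loc (fun s => Im (RtoC s * z * Cexp (U (s ^ m)%R, V (s ^ m)%R))%C)).
      + revert Hloc; apply filter_imp; intros s Hs; now rewrite Hfs.
      + rewrite F1; unfold Cexp, g; destruct z as [x y]; simpl.
        auto_derive; [tauto|].
        change (fun x : R => U x) with U; change (fun x : R => V x) with V.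
        rewrite !pow1; ring_R. }
  assert (Hu : forall n, u n = (RtoC (INR m) * (RtoC (INR n) * b n))%C).
  { intros n; unfold u, b; destruct n as [|n].
    - simpl (0 =? 0)%nat; cbv iota; rewrite Rmult_0_r, Rmult_0_l; ring.
    - change (S n =? 0)%nat with false; cbv iota; rewrite !RtoC_mult; ring. }
  split.
  - apply (ex_series_ext (fun n => scal (INR m) (Rabs (INR n * Cmod (b n))))).
    + intros n; rewrite Hu, !Cmod_mult, !Cmod_R, Rabs_mult.
      rewrite (Rabs_pos_eq (INR m)) by apply pos_INR.
      rewrite (Rabs_pos_eq (Cmod _)) by apply Cmod_ge_0; reflexivity.
    + apply (ex_series_scal (V := R_NormedModule)), ex_series_abs_derive_1, CVm.
  - replace (zf'_over_f f z - 1)%C with g.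
    2:{ unfold zf'_over_f; destruct (Ceq_dec z (RtoC 0)) as [E|_]; [contradiction|].
        rewrite Hder; field; exact Hfz. }
    apply is_series_C; split.
    + apply (is_series_ext (fun n => scal (INR m) (INR n * Re (b n)))).
      * intros n; now rewrite Hu, !re_scal_l.
      * apply (is_series_scal (V := R_NormedModule)), is_series_derive_1, CVr.
    + apply (is_series_ext (fun n => scal (INR m) (INR n * Im (b n)))).
      * intros n; now rewrite Hu, !im_scal_l.
      * apply (is_series_scal (V := R_NormedModule)), is_series_derive_1, CVi.
Qed.

(** * Bounds for the logarithmic coefficients *)

(** With [W = w(z)^(j + k - 1)], the right-hand side is the modulus of [(A - B) / (1 + B W)] and the
    left-hand side is that of [W] times the same quotient. The denominator is nonzero because
    [|B| <= 1] and [|W| < 1]. *)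
Lemma zf'_over_f_bound (j k : nat) (A : C) (B : R) (f : C -> C) (z : C) :
  (1 <= j + k - 1)%nat -> -1 <= B <= 1 -> class_ST j k A B f -> unit_disc z ->
  Cmod (zf'_over_f f z - 1)
  <= Cmod ((A - RtoC B) - RtoC B * (zf'_over_f f z - 1))%C.
Proof.
  intros Hm HB (_ & _ & _ & _ & _ & _ & w & _ & Hw & _ & Hsub) Hz.
  rewrite (Hsub z Hz).
  specialize (Hw z Hz); unfold unit_disc in Hw.
  set (W := (w z ^ (j + k - 1))%C).
  assert (HW : Cmod W < 1).
  { unfold W; rewrite Cmod_pow.
    apply pow_lt_1_compat; [split; [apply Cmod_ge_0|exact Hw]|lia]. }
  assert (HN : (1 + RtoC B * W)%C <> RtoC 0).
  { intros E.
    assert (E1 : Cmod (RtoC B * W)%C = 1).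
    { replace (RtoC B * W)%C with (- (1))%C by (rewrite <- (Cplus_0_r (- (1))%C), <- E; ring).
      apply Cmod_m1. }
    rewrite Cmod_mult, Cmod_R in E1.
    assert (Rabs B <= 1) by (apply Rabs_le; lra).
    pose proof (Rabs_pos B); pose proof (Cmod_ge_0 W); nra. }
  replace ((1 + A * W) / (1 + RtoC B * W) - 1)%C
    with (W * ((A - RtoC B) / (1 + RtoC B * W)))%C by (field; exact HN).
  replace (A - RtoC B - RtoC B * (W * ((A - RtoC B) / (1 + RtoC B * W))))%C
    with ((A - RtoC B) / (1 + RtoC B * W))%C by (field; exact HN).
  rewrite Cmod_mult.
  pose proof (Cmod_ge_0 ((A - RtoC B) / (1 + RtoC B * W))); nra.
Qed.

Lemma sum_pow_scaled_continuous (x : nat -> R) (e : nat -> nat) (N : nat) :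
  continuity_pt (fun r => sum_n (fun n => (x n * r ^ e n) ^ 2) N) 1.
Proof.
  apply derivable_continuous_pt, ex_derive_Reals_0.
  apply (ex_derive_sum_n (V := R_NormedModule) (fun n r => (x n * r ^ e n) ^ 2)).
  intros n _; auto_derive; exact I.
Qed.

Lemma nonneg_at_1 (F : R -> R) :
  continuity_pt F 1 -> (forall r, 0 < r < 1 -> 0 <= F r) -> 0 <= F 1.
Proof.
  intros Hc HF.
  destruct (Rle_lt_dec 0 (F 1)) as [H|H]; [exact H|exfalso].
  destruct (Hc (- F 1) ltac:(lra)) as [del [Hdel Hd]].
  (* The bound [1 / 2] keeps [r] positive, and [del / 2] keeps it within [del] of 1. *)
  set (r := 1 - Rmin (1 / 2) (del / 2)).
  assert (0 < Rmin (1 / 2) (del / 2)) by (apply Rmin_pos; lra).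
  pose proof (Rmin_l (1 / 2) (del / 2)); pose proof (Rmin_r (1 / 2) (del / 2)).
  specialize (HF r ltac:(unfold r; lra)).
  assert (Hr : Rabs (F r - F 1) < - F 1).
  { apply (Hd r); split.
    - split; [exact I|unfold r; lra].
    - simpl; unfold Rdist; apply Rabs_def1; unfold r; lra. }
  apply Rabs_def2 in Hr; lra.
Qed.

(** [clunie_step] is applied on each circle of radius [r < 1], where the expansion converges
    absolutely; then [r] tends to 1. *)
Lemma log_coefficients_step (j k : nat) (A : C) (B : R) (f : C -> C) (d : nat -> C) (p : nat) :
  (1 <= j + k - 1)%nat -> -1 <= B <= 1 -> A <> RtoC B ->
  class_ST j k A B f -> log_coefficients (j + k - 1) f d ->
  let c := fun n => (RtoC (2 * INR n * INR (j + k - 1)) * d (n * (j + k - 1))%nat)%C in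
  sum_n (fun n => Cmod (c n) ^ 2) (S p)
  <= Cmod (A - RtoC B) ^ 2 + B ^ 2 * sum_n (fun n => Cmod (c n) ^ 2) p.
Proof.
  intros Hm HB HAB Hf Hd c.
  pose proof (fun z => zf'_over_f_bound j k A B f z Hm HB Hf) as Hbound.
  destruct Hf as [[Han _] [_ [_ [Hnz _]]]].
  destruct Hd as [L [_ [_ [HL Hser]]]].
  set (m := (j + k - 1)%nat) in *.
  assert (Hmp : 0 < INR m) by (apply lt_0_INR; lia).
  assert (Hr : forall r, 0 < r < 1 ->
    sum_n (fun n => (Cmod (c n) * r ^ (n * m)) ^ 2) (S p)
    <= Cmod (A - RtoC B) ^ 2
       + B ^ 2 * sum_n (fun n => (Cmod (c n) * r ^ (n * m)) ^ 2) p).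
  { intros r Hr.
    (* Dividing the angle by [m] turns [z^(nm)] into [r^(nm) cis (n x)], so the gaps in the power
       series disappear from the Fourier series. *)
    set (z := fun x => (RtoC r * cis (x / INR m))%C).
    assert (Hzm : forall x, Cmod (z x) = r).
    { intros x; unfold z; rewrite Cmod_mult, Cmod_R, Cmod_cis, Rabs_pos_eq; lra. }
    assert (Hzd : forall x, unit_disc (z x)) by (intros x; unfold unit_disc; rewrite Hzm; lra).
    assert (Hz0 : forall x, z x <> RtoC 0) by (intros x; apply Cmod_gt_0; rewrite Hzm; lra).
    pose proof (fun x => log_derivative_series m f L d (z x) Hm Han HL Hser (Hzd x) (Hz0 x)
                  (Hnz _ (Hzd x) (Hz0 x))) as Hs.
    cbv zeta in Hs.
    assert (Hmod : forall n, Cmod (c n * RtoC (r ^ (n * m)))%C = Cmod (c n) * r ^ (n * m)).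
    { intros n; rewrite Cmod_mult, Cmod_R, Rabs_pos_eq; [reflexivity|apply pow_le; lra]. }
    assert (F : is_fourier (fun n => c n * RtoC (r ^ (n * m)))%C
                  (fun x => zf'_over_f f (z x) - 1)%C).
    { split.
      - destruct (Hs 0) as [Hs0 _]; revert Hs0; apply ex_series_ext.
        intros n; rewrite Hmod; fold (c n); now rewrite Cmod_mult, Cmod_pow, Hzm.
      - intros x; destruct (Hs x) as [_ Hsx]; revert Hsx; apply is_series_ext.
        intros n; fold (c n).
        unfold z; rewrite Cpow_mult_l, cis_pow, RtoC_pow.
        replace (INR (n * m) * (x / INR m)) with (INR n * x)
          by (rewrite mult_INR; field; lra).
        ring_C. }
    pose proof (clunie_step _ _ (A - RtoC B)%C B p F) as P.
    rewrite (sum_n_ext (G := R_AbelianMonoid) _ (fun n => (Cmod (c n) * r ^ (n * m)) ^ 2)) in P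
      by (intros n; now rewrite Hmod).
    rewrite (sum_n_ext (G := R_AbelianMonoid) (fun n => Cmod _ ^ 2)
               (fun n => (Cmod (c n) * r ^ (n * m)) ^ 2)) in P
      by (intros n; now rewrite Hmod).
    apply P.
    - unfold c; rewrite Rmult_0_r, Rmult_0_l; ring.
    - intros E; apply HAB; replace A with (A - RtoC B + RtoC B)%C by ring; rewrite E; ring.
    - exact HB.
    - intros x; apply Hbound, Hzd. }
  set (S1 := fun N r => sum_n (fun n => (Cmod (c n) * r ^ (n * m)) ^ 2) N).
  assert (H1 : forall N, S1 N 1 = sum_n (fun n => Cmod (c n) ^ 2) N).
  { intros N; apply sum_n_ext; intros n; now rewrite pow1, Rmult_1_r. }
  rewrite <- !H1.
  (* Both sides are polynomials in [r], so the inequality extends to [r = 1] by continuity. *)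
  assert (G : 0 <= (Cmod (A - RtoC B) ^ 2 + B ^ 2 * S1 p 1) - S1 (S p) 1).
  { apply (nonneg_at_1 (fun r => (Cmod (A - RtoC B) ^ 2 + B ^ 2 * S1 p r) - S1 (S p) r)).
    - apply continuity_pt_minus; [apply continuity_pt_plus|].
      + apply continuity_pt_const; intros ? ?; reflexivity.
      + apply continuity_pt_scal, sum_pow_scaled_continuous.
      + apply sum_pow_scaled_continuous.
    - intros r Hr'; specialize (Hr r Hr'); unfold S1; lra. }
  lra.
Qed.

(** Iterating the previous inequality from [c 0 = 0] produces the geometric sum in [B ^ 2]. The sums
    here start at [c 1], hence the shift of index. *)
Lemma log_coefficients_sum_le (j k : nat) (A : C) (B : R) (f : C -> C) (d : nat -> C) (p : nat) :
  (1 <= j + k - 1)%nat -> -1 <= B <= 1 -> A <> RtoC B ->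
  class_ST j k A B f -> log_coefficients (j + k - 1) f d ->
  sum_n (fun n => (2 * INR (S n) * INR (j + k - 1)
                   * Cmod (d (S n * (j + k - 1))%nat)) ^ 2) p
  <= sum_n (fun n => Cmod (A - RtoC B) ^ 2 * B ^ (2 * n)) p.
Proof.
  intros Hm HB HAB Hf Hd.
  pose proof (fun q => log_coefficients_step j k A B f d q Hm HB HAB Hf Hd) as Hstep.
  cbv zeta in Hstep.
  set (m := (j + k - 1)%nat) in *.
  set (c := fun n => (RtoC (2 * INR n * INR m) * d (n * m)%nat)%C) in Hstep.
  assert (c0 : c 0%nat = RtoC 0) by (unfold c; rewrite Rmult_0_r, Rmult_0_l; ring).
  assert (Hsh : forall q, sum_n (fun n => (2 * INR (S n) * INR m * Cmod (d (S n * m)%nat)) ^ 2) q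
                          = sum_n (fun n => Cmod (c n) ^ 2) (S q)).
  { assert (Hc : forall n, (2 * INR (S n) * INR m * Cmod (d (S n * m)%nat)) ^ 2
                           = Cmod (c (S n)) ^ 2).
    { intros n; unfold c; rewrite Cmod_mult, Cmod_R, Rabs_pos_eq; [reflexivity|].
      pose proof (pos_INR (S n)); pose proof (pos_INR m); nra. }
    induction q as [|q IH].
    - rewrite sum_Sn, !sum_O, c0, Hc, Cmod_0; change plus with Rplus; ring_R.
    - rewrite sum_Sn, IH, (sum_Sn _ (S q)), Hc; reflexivity. }
  induction p as [|p IH]; rewrite Hsh.
  - eapply Rle_trans; [apply Hstep|].
    rewrite !sum_O, c0, Cmod_0; right; simpl; ring_R.
  - eapply Rle_trans; [apply Hstep|].
    rewrite <- Hsh.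
    (* The geometric sum satisfies the same recursion with equality. *)
    assert (E : forall q, sum_n (fun n => Cmod (A - RtoC B) ^ 2 * B ^ (2 * n)) (S q)
      = Cmod (A - RtoC B) ^ 2 + B ^ 2 * sum_n (fun n => Cmod (A - RtoC B) ^ 2 * B ^ (2 * n)) q).
    { induction q as [|q IHq].
      - rewrite sum_Sn, !sum_O; change plus with Rplus; simpl; ring_R.
      - rewrite sum_Sn; rewrite IHq at 1; rewrite (sum_Sn _ q); change plus with Rplus.
        replace (2 * S (S q))%nat with (2 + 2 * S q)%nat by lia.
        rewrite (pow_add B 2); ring_R. }
    rewrite E.
    apply Rplus_le_compat_l, Rmult_le_compat_l; [apply pow2_ge_0|exact IH].
Qed.

(** * Summation by parts and the weights *)

Lemma abel_sum_le (mu x y : nat -> R) :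
  (forall n, 0 <= mu n) -> (forall n, mu (S n) <= mu n) ->
  (forall p, sum_n x p <= sum_n y p) ->
  forall p, sum_n (fun n => mu n * x n) p <= sum_n (fun n => mu n * y n) p.
Proof.
  intros Hpos Hdec Hxy p.
  (* The induction needs this stronger form, which keeps the boundary term of the summation by
     parts. *)
  assert (H : mu p * (sum_n y p - sum_n x p)
              <= sum_n (fun n => mu n * y n) p - sum_n (fun n => mu n * x n) p).
  { induction p as [|p IH].
    - rewrite !sum_O; lra.
    - rewrite !sum_Sn; change plus with Rplus.
      specialize (Hxy p); specialize (Hdec p); nra. }
  specialize (Hxy p); specialize (Hpos p); nra.
Qed.

(** The weight [(y + 1)^t / y^2] is the product of [((y + 1) / y)^2] and [(y + 1)^(t - 2)]. The
    first factor decreases because [y (y + 2) <= (y + 1)^2], and the second does not increase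
    because [t <= 2]. *)
Lemma weight_decreasing (t : R) (n : nat) :
  t <= 2 ->
  Rpower (INR (S (S n) + 1)) t / INR (S (S n)) ^ 2
  <= Rpower (INR (S n + 1)) t / INR (S n) ^ 2.
Proof.
  intros Ht.
  assert (Hn : 0 < INR (S n)) by (apply lt_0_INR; lia).
  rewrite !plus_INR, (S_INR (S n)); simpl (INR 1).
  set (x := INR (S n)) in *.
  assert (Hsplit : forall y, 0 < y -> Rpower (y + 1) t = (y + 1) ^ 2 * Rpower (y + 1) (t - 2)).
  { intros y Hy; rewrite <- (Rpower_pow 2) by lra.
    rewrite <- Rpower_plus; f_equal; simpl; ring. }
  rewrite !Hsplit by lra.
  assert (Hp : Rpower (x + 1 + 1) (t - 2) <= Rpower (x + 1) (t - 2)).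
  { unfold Rpower.
    assert (ln (x + 1) < ln (x + 1 + 1)) by (apply ln_increasing; lra).
    destruct (Req_dec t 2) as [->|Hne].
    - rewrite Rminus_diag, !Rmult_0_l; lra.
    - apply Rlt_le, exp_increasing; nra. }
  assert (Hq : (x + 1 + 1) ^ 2 / (x + 1) ^ 2 <= (x + 1) ^ 2 / x ^ 2).
  { apply (Rmult_le_reg_r ((x + 1) ^ 2 * x ^ 2)); [nra|].
    replace ((x + 1 + 1) ^ 2 / (x + 1) ^ 2 * ((x + 1) ^ 2 * x ^ 2))
      with (((x + 1 + 1) * x) ^ 2) by (field; lra).
    replace ((x + 1) ^ 2 / x ^ 2 * ((x + 1) ^ 2 * x ^ 2))
      with (((x + 1) * (x + 1)) ^ 2) by (field; lra).
    apply pow_incr; nra. }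
  replace ((x + 1 + 1) ^ 2 * Rpower (x + 1 + 1) (t - 2) / (x + 1) ^ 2)
    with ((x + 1 + 1) ^ 2 / (x + 1) ^ 2 * Rpower (x + 1 + 1) (t - 2)) by (field; lra).
  replace ((x + 1) ^ 2 * Rpower (x + 1) (t - 2) / x ^ 2)
    with ((x + 1) ^ 2 / x ^ 2 * Rpower (x + 1) (t - 2)) by (field; lra).
  apply Rmult_le_compat; [|apply Rlt_le, exp_pos|exact Hq|exact Hp].
  apply Rlt_le, Rdiv_lt_0_compat; nra.
Qed.

(** The sum may be infinite; for [a = 0] the convention of [Rbar_mult] that zero times infinity is
    zero agrees with the right-hand side. *)
Lemma rsum1_scal_l (a : R) (u : nat -> R) :
  Rbar_mult (Finite a) (rsum1 u) = rsum1 (fun n => a * u n).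
Proof.
  unfold rsum1; rewrite <- Lim_seq_scal_l.
  apply Lim_seq_ext; intros n; symmetry.
  exact (sum_n_mult_l (K := R_Ring) a (fun n => u (S n)) n).
Qed.

(** The comparison is between partial sums, since summation by parts gives no inequality between
    individual terms. *)
Lemma rsum1_le (u v : nat -> R) :
  (forall p, sum_n (fun n => u (S n)) p <= sum_n (fun n => v (S n)) p) ->
  Rbar_le (rsum1 u) (rsum1 v).
Proof. intros H; apply Lim_seq_le_loc; exists 0%nat; intros n _; apply H. Qed.

Theorem theorem2p5 :
  forall (j k : nat) (A : C) (B t : R) (f : C -> C) (d : nat -> C),
    admissible j k ->
    -1 <= B <= 0 ->
    A <> RtoC B ->
    class_ST j k A B f ->
    log_coefficients (j + k - 1) f d ->
    t <= 2 ->
    (B <> 0 ->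
      Rbar_le
        (rsum1 (fun n => Rpower (INR (n + 1)) t
                         * Cmod (d (n * (j + k - 1))%nat) ^ 2))
        (Rbar_mult
          (Finite ((Cmod (A - RtoC B)%C / (2 * INR (j + k - 1) * B)) ^ 2))
          (rsum1 (fun n => Rpower (INR (n + 1)) t / INR n ^ 2
                           * B ^ (2 * n)))))
    /\
    (* for B = 0 the factor 1/B^2 is absorbed into the sum, where 0 ^ 0 = 1 *)
    (B = 0 ->
      Rbar_le
        (rsum1 (fun n => Rpower (INR (n + 1)) t
                         * Cmod (d (n * (j + k - 1))%nat) ^ 2))
        (Rbar_mult
          (Finite ((Cmod (A - RtoC B)%C / (2 * INR (j + k - 1))) ^ 2))
          (rsum1 (fun n => Rpower (INR (n + 1)) t / INR n ^ 2
                           * B ^ (2 * n - 2))))).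
Proof.
  intros j k A B t f d [_ Hm] HB HAB Hf Hd Ht.
  pose proof (fun p => log_coefficients_sum_le j k A B f d p Hm ltac:(lra) HAB Hf Hd) as Hsum.
  set (m := (j + k - 1)%nat) in *.
  assert (Hmp : 0 < INR m) by (apply lt_0_INR; lia).
  (* [mu n] is the weight of index [n + 1]; the division by [(2 m)^2] turns the bound on the
     [|c_n|^2] into one on the [|d_{nm}|^2]. *)
  set (mu := fun n => Rpower (INR (S n + 1)) t / INR (S n) ^ 2 / (2 * INR m) ^ 2).
  assert (Hm2 : 0 < (2 * INR m) ^ 2) by nra.
  assert (Hpos : forall n, 0 <= mu n).
  { intros n; assert (0 < INR (S n)) by (apply lt_0_INR; lia).
    unfold mu; apply Rlt_le, Rdiv_lt_0_compat; [|exact Hm2].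
    apply Rdiv_lt_0_compat; [apply exp_pos|nra]. }
  assert (Hdec : forall n, mu (S n) <= mu n).
  { intros n; unfold mu; apply Rmult_le_compat_r.
    - apply Rlt_le, Rinv_0_lt_compat, Hm2.
    - now apply weight_decreasing. }
  (* Once the constant is moved inside the sum, both cases of the theorem have terms of this form,
     so they are settled together through [v]. *)
  assert (Hle : forall v : nat -> R,
    (forall n, v (S n) = mu n * (Cmod (A - RtoC B) ^ 2 * B ^ (2 * n))) ->
    Rbar_le (rsum1 (fun n => Rpower (INR (n + 1)) t * Cmod (d (n * m)%nat) ^ 2)) (rsum1 v)).
  { intros v Hv; apply rsum1_le; intros p.
    rewrite (sum_n_ext (G := R_AbelianMonoid) _ _ _ Hv).
    eapply Rle_trans; [|apply (abel_sum_le mu _ _ Hpos Hdec Hsum)].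
    right; apply sum_n_ext; intros n; unfold mu.
    assert (0 < INR (S n)) by (apply lt_0_INR; lia).
    match goal with |- ?a = ?b => change (@eq R a b) end; field; lra. }
  split; intros HB0; rewrite rsum1_scal_l; apply Hle; intros n; unfold mu;
    assert (0 < INR (S n)) by (apply lt_0_INR; lia).
  (* The extra [B ^ 2] at index [S n] cancels the one in the denominator of the constant. *)
  - replace (2 * S n)%nat with (2 + 2 * n)%nat by lia.
    rewrite pow_add; field; lra.
  - replace (2 * S n - 2)%nat with (2 * n)%nat by lia.
    field; lra.
Qed.
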